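(* Let $A$ be an Artin algebra, let $J=\operatorname{rad}A$ and let $m\geq 1$ be an integer. Assume that $J^{2m+1}=0$ and that $C=A/J^m$ has finite representation type. If $V$ is an additive generator of the category of finitely generated left $C$-modules, viewed as an $A$-module, then $$W=A\oplus V\oplus\Omega_AV$$ is a $1$-Igusa--Todorov witness for $A$; that is, every finitely generated left $A$-module $Y$ admits an exact sequence $0\to W_1\to W_0\to\Omega_AY\to 0$ of $A$-modules with $W_0,W_1\in\operatorname{add}W$.
   Context: An Artin algebra is an algebra $A$ over a commutative Artinian ring $R$ that is finitely generated as an $R$-module; $\operatorname{rad}A$ is its Jacobson radical. All modules are finitely generated left modules. For a module $V$, $\operatorname{add}V$ is the full subcategory of direct summands of finite direct sums of copies of $V$. An Artin algebra $C$ has finite representation type if there are only finitely many isomorphism classes of finitely generated indecomposable left $C$-modules. A $C$-module $V$ is an additive generator of the category of finitely generated left $C$-modules if every finitely generated left $C$-module lies in $\operatorname{add}V$. For an $A$-module $X$, $\Omega_AX$ is the kernel of a projective cover $P_X\twoheadrightarrow X$ of $A$-modules. *)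

(* Defs.v *)
From HB Require Import structures.
From mathcomp Require Import all_boot all_algebra.
From mathcomp Require Import boolp.

Set Implicit Arguments.
Unset Strict Implicit.
Unset Printing Implicit Defensive.

Import GRing.Theory.
Local Open Scope ring_scope.
Local Open Scope quotient_scope.

(* Subsets are boolean predicates; since [boolp] makes every proposition
   decidable, these are arbitrary subsets. *)

Definition left_ideal (A : pzRingType) (I : {pred A}) : Prop :=
  submod_closed (I : {pred A^o}).

Definition artinian (R : comPzRingType) : Prop :=
  forall I : nat -> {pred R},
    (forall n, left_ideal (I n)) -> (forall n, {subset I n.+1 <= I n}) ->
  exists n, forall k, (n <= k)%N -> I k =i I n.

Definition maximal_left_ideal (A : pzRingType) (M : {pred A}) : Prop :=
  [/\ left_ideal M, 1 \notin M &
      forall N : {pred A}, left_ideal N -> 1 \notin N ->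
        {subset M <= N} -> N =i M].

Definition jrad (A : pzRingType) : {pred A} :=
  fun x => `[< forall M : {pred A}, maximal_left_ideal M -> x \in M >].
Arguments jrad : clear implicits.

HB.mixin Record isTwoSided (A : pzRingType) (I : A -> bool) := {
  idealMl : forall a x : A, x \in I -> a * x \in I;
  idealMr : forall a x : A, x \in I -> x * a \in I
}.

#[short(type="twoSidedIdeal")]
HB.structure Definition TwoSidedIdeal (A : pzRingType) :=
  {I of GRing.ZmodClosed A I & isTwoSided A I}.

Definition ideal_mul (A : pzRingType) (I K : {pred A}) : {pred A} :=
  fun x => `[< exists s : seq (A * A),
    {in s, forall u, u.1 \in I /\ u.2 \in K} /\ x = \sum_(u <- s) u.1 * u.2 >].

Definition ideal_exp (A : pzRingType) (I : {pred A}) (n : nat) : {pred A} :=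
  iter n (ideal_mul I) predT.

Section JacobsonRadical.
Variable A : pzRingType.

Lemma left_idealP (I : {pred A}) : left_ideal I <->
  [/\ 0 \in I, {in I &, forall x y, x + y \in I}
    & forall a x, x \in I -> a * x \in I].
Proof.
split=> [[I0 IL]|[I0 ID IM]].
  split=> // [x y xI yI|a x xI].
    by have := IL 1 x y xI yI; rewrite scale1r.
  by have := IL a x 0 xI I0; rewrite addr0.
by split=> // a x y xI yI; apply: ID => //; apply: IM.
Qed.

Lemma maximal_left_ideal_colon (M : {pred A}) (a : A) :
  maximal_left_ideal M -> a \notin M ->
  maximal_left_ideal [pred y | y * a \in M].
Proof.
move=> [/left_idealP[M0 MD MM] M1 Mmax] aM; split.
- apply/left_idealP; split=> [|x y|b x]; rewrite !inE ?mul0r //.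
    by move=> xM yM; rewrite mulrDl MD.
  by move=> xM; rewrite -mulrA MM.
- by rewrite inE mul1r.
move=> N /left_idealP[N0 ND NM] N1 MN b; apply/idP/idP => [bN|]; last exact: MN.
rewrite inE; apply/negPn/negP => baM.
pose K : {pred A} :=
  fun x => `[< exists2 y, y \in M & exists c, x = y + c * (b * a) >].
have [y yM [c ac]] : exists2 y, y \in M & exists c, 1 = y + c * (b * a).
  apply/asboolP; apply/negPn/negP => K1.
  have KI : left_ideal K.
    apply/left_idealP; split.
    - by apply/asboolP; exists 0 => //; exists 0; rewrite mul0r addr0.
    - move=> x y /asboolP[u uM [c ->]] /asboolP[v vM [d ->]].
      apply/asboolP; exists (u + v); first exact: MD.
      by exists (c + d); rewrite mulrDl addrACA.
    - move=> d x /asboolP[u uM [c ->]].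
      apply/asboolP; exists (d * u); first exact: MM.
      by exists (d * c); rewrite mulrDr !mulrA.
  have MK : {subset M <= K}.
    by move=> x xM; apply/asboolP; exists x => //; exists 0; rewrite mul0r addr0.
  have /negP[] := baM; rewrite -(Mmax K KI K1 MK).
  by apply/asboolP; exists 0 => //; exists 1; rewrite mul1r add0r.
have /negP[] := N1.
suff h : 1 - a * c * b \in [pred y | y * a \in M].
  by rewrite -[1](subrK (a * c * b)); apply: ND; [apply: MN | apply: NM].
rewrite inE mulrBl mul1r -!mulrA -{1}[a]mulr1 -mulrBr.
by rewrite {1}ac addrK MM.
Qed.

Lemma jrad_zmod_closed : zmod_closed (jrad A).
Proof.
split=> [|x y /asboolP xJ /asboolP yJ]; apply/asboolP => M Mmax;
  have [/left_idealP[M0 MD MM] _ _] := Mmax => //.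
by rewrite MD ?xJ // -mulN1r MM ?yJ.
Qed.

Lemma jrad_Ml (a x : A) : x \in jrad A -> a * x \in jrad A.
Proof.
move=> /asboolP xJ; apply/asboolP => M Mmax.
by have [/left_idealP[_ _ MM] _ _] := Mmax; apply: MM; apply: xJ.
Qed.

Lemma jrad_Mr (a x : A) : x \in jrad A -> x * a \in jrad A.
Proof.
move=> /asboolP xJ; apply/asboolP => M Mmax.
have [aM|aM] := boolP (a \in M).
  by have [/left_idealP[_ _ MM] _ _] := Mmax; apply: MM.
by have := xJ _ (maximal_left_ideal_colon Mmax aM); rewrite inE.
Qed.

End JacobsonRadical.

HB.instance Definition _ (A : pzRingType) :=
  GRing.isZmodClosed.Build A (jrad A) (@jrad_zmod_closed A).
HB.instance Definition _ (A : pzRingType) :=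
  isTwoSided.Build A (jrad A) (@jrad_Ml A) (@jrad_Mr A).

Section IdealExp.
Variables (A : pzRingType) (I : twoSidedIdeal A).

Lemma ideal_exp_two_sided n :
  [/\ zmod_closed (ideal_exp I n),
      forall a x, x \in ideal_exp I n -> a * x \in ideal_exp I n
    & forall a x, x \in ideal_exp I n -> x * a \in ideal_exp I n].
Proof.
elim: n => [//|n [_ IHl IHr]]; split.
- split=> [|x y /asboolP[s [sI ->]] /asboolP[t [tI ->]]]; apply/asboolP.
    by exists [::]; rewrite big_nil.
  exists (s ++ [seq (- u.1, u.2) | u <- t]); split=> [u|].
    rewrite mem_cat => /orP[/sI//|/mapP[v /tI[v1 v2] ->]].
    by rewrite /= rpredN.
  rewrite big_cat big_map /= -sumrN; congr (_ + _).
  by apply: eq_bigr => u _; rewrite mulNr.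
- move=> a x /asboolP[s [sI ->]]; apply/asboolP.
  exists [seq (a * u.1, u.2) | u <- s]; split=> [u /mapP[v /sI[v1 v2] ->]|].
    by split=> //=; apply: idealMl.
  by rewrite big_map mulr_sumr; apply: eq_bigr => u _; rewrite mulrA.
- move=> a x /asboolP[s [sI ->]]; apply/asboolP.
  exists [seq (u.1, u.2 * a) | u <- s]; split=> [u /mapP[v /sI[v1 v2] ->]|].
    by split=> //=; apply: IHr.
  by rewrite big_map mulr_suml; apply: eq_bigr => u _; rewrite mulrA.
Qed.

Lemma ideal_exp_zmod_closed n : zmod_closed (ideal_exp I n).
Proof. by case: (ideal_exp_two_sided n). Qed.

Lemma ideal_exp_Ml n a x : x \in ideal_exp I n -> a * x \in ideal_exp I n.
Proof. by case: (ideal_exp_two_sided n) => _ + _; apply. Qed.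

Lemma ideal_exp_Mr n a x : x \in ideal_exp I n -> x * a \in ideal_exp I n.
Proof. by case: (ideal_exp_two_sided n) => _ _; apply. Qed.

HB.instance Definition _ n :=
  GRing.isZmodClosed.Build A (ideal_exp I n) (ideal_exp_zmod_closed n).
HB.instance Definition _ n :=
  isTwoSided.Build A (ideal_exp I n) (@ideal_exp_Ml n) (@ideal_exp_Mr n).

End IdealExp.

(* A new key over [Quotient.quot]: MathComp puts a ring structure on the latter
   only for proper ideals of commutative rings. *)
Definition ring_quot (A : pzRingType) (I : twoSidedIdeal A) : Type :=
  Quotient.quot I.

Section RingQuot.
Variables (A : pzRingType) (I : twoSidedIdeal A).
Local Notation Q := (ring_quot I).

HB.instance Definition _ := GRing.Zmodule.on Q.

Definition ring_quot_proj (a : A) : Q := \pi_(Quotient.quot I) a.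
Local Notation pr := ring_quot_proj.

Definition ring_quot_mul (x y : Q) : Q :=
  pr (repr (x : Quotient.quot I) * repr (y : Quotient.quot I)).

Lemma ring_quot_projP (a b : A) : reflect (pr a = pr b) (a - b \in I).
Proof. by rewrite Quotient.idealrBE; apply: eqP. Qed.

Lemma ring_quot_proj_surj (x : Q) : exists a, pr a = x.
Proof. by exists (repr (x : Quotient.quot I)); apply: reprK. Qed.

Lemma ring_quot_proj_is_zmod_morphism : zmod_morphism pr.
Proof. exact: pi_is_zmod_morphism. Qed.

Lemma ring_quot_projM a b : pr (a * b) = ring_quot_mul (pr a) (pr b).
Proof.
apply/ring_quot_projP.
set a' := repr _; set b' := repr _.
have aI : a - a' \in I by apply/ring_quot_projP; rewrite /pr reprK.
have bI : b - b' \in I by apply/ring_quot_projP; rewrite /pr reprK.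
rewrite -(subrK (a' * b) (a * b)) -addrA -mulrBl -mulrBr.
by apply: rpredD; [apply: idealMr | apply: idealMl].
Qed.

Lemma ring_quot_mulA : associative ring_quot_mul.
Proof.
move=> x y z; have [a <-] := ring_quot_proj_surj x.
have [b <-] := ring_quot_proj_surj y; have [c <-] := ring_quot_proj_surj z.
by rewrite -!ring_quot_projM mulrA.
Qed.

Lemma ring_quot_mul1 : left_id (pr 1) ring_quot_mul.
Proof.
move=> x; have [a <-] := ring_quot_proj_surj x.
by rewrite -ring_quot_projM mul1r.
Qed.

Lemma ring_quot_mulr1 : right_id (pr 1) ring_quot_mul.
Proof.
move=> x; have [a <-] := ring_quot_proj_surj x.
by rewrite -ring_quot_projM mulr1.
Qed.

HB.instance Definition _ :=
  GRing.isZmodMorphism.Build A Q ring_quot_proj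
    ring_quot_proj_is_zmod_morphism.

Lemma ring_quot_mulDl : left_distributive ring_quot_mul +%R.
Proof.
move=> x y z; have [a <-] := ring_quot_proj_surj x.
have [b <-] := ring_quot_proj_surj y; have [c <-] := ring_quot_proj_surj z.
by rewrite -!ring_quot_projM -!raddfD -ring_quot_projM mulrDl.
Qed.

Lemma ring_quot_mulDr : right_distributive ring_quot_mul +%R.
Proof.
move=> x y z; have [a <-] := ring_quot_proj_surj x.
have [b <-] := ring_quot_proj_surj y; have [c <-] := ring_quot_proj_surj z.
by rewrite -!ring_quot_projM -!raddfD -ring_quot_projM mulrDr.
Qed.

HB.instance Definition _ := GRing.Zmodule_isPzRing.Build Q
  ring_quot_mulA ring_quot_mul1 ring_quot_mulr1 ring_quot_mulDl ring_quot_mulDr.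

Lemma ring_quot_proj_is_monoid_morphism : monoid_morphism pr.
Proof. by split=> // a b; rewrite ring_quot_projM. Qed.

HB.instance Definition _ :=
  GRing.isMonoidMorphism.Build A Q ring_quot_proj
    ring_quot_proj_is_monoid_morphism.

End RingQuot.

Arguments ring_quot_proj {A} I.

Definition restrict_scalars (A C : pzRingType) (f : {rmorphism A -> C})
  (V : lmodType C) : Type := V.

Section Restrict.
Variables (A C : pzRingType) (f : {rmorphism A -> C}) (V : lmodType C).
Local Notation fV := (restrict_scalars f V).

HB.instance Definition _ := GRing.Zmodule.on fV.

Definition restrict_scale (a : A) (v : fV) : fV := f a *: (v : V).

Lemma restrict_scaleA a b v :
  restrict_scale a (restrict_scale b v) = restrict_scale (a * b) v.
Proof. by rewrite /restrict_scale scalerA rmorphM. Qed.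

Lemma restrict_scale1 : left_id 1 restrict_scale.
Proof. by move=> v; rewrite /restrict_scale rmorph1 scale1r. Qed.

Lemma restrict_scaleDr : right_distributive restrict_scale +%R.
Proof. by move=> a u v; apply: scalerDr. Qed.

Lemma restrict_scaleDl v :
  {morph restrict_scale^~ v : a b / a + b}.
Proof. by move=> a b; rewrite /restrict_scale rmorphD scalerDl. Qed.

HB.instance Definition _ := GRing.Zmodule_isLmodule.Build A fV
  restrict_scaleA restrict_scale1 restrict_scaleDr restrict_scaleDl.

End Restrict.

Section Kernel.
Variables (A : pzRingType) (M N : lmodType A) (f : {linear M -> N}).

Definition ker_pred : {pred M} := fun x => f x == 0.

Lemma ker_pred_closed : submod_closed ker_pred.
Proof.
split=> [|a x y /eqP fx /eqP fy]; apply/eqP; first exact: linear0.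
by rewrite linearP fx fy scaler0 addr0.
Qed.

HB.instance Definition _ := GRing.isSubmodClosed.Build A M ker_pred
  ker_pred_closed.

Definition ker_mod : Type := {x : M | x \in ker_pred}.

HB.instance Definition _ := SubType.on ker_mod.
HB.instance Definition _ := [Choice of ker_mod by <:].
HB.instance Definition _ := [SubChoice_isSubLmodule of ker_mod by <:].

End Kernel.

Definition fin_gen (A : pzRingType) (M : lmodType A) : Prop :=
  exists (n : nat) (e : 'I_n -> M),
    forall x, exists c : 'I_n -> A, x = \sum_i c i *: e i.

Definition artin_algebra (R : comPzRingType) (A : algType R) : Prop :=
  artinian R /\ fin_gen (A : lmodType R).

Definition mod_iso (A : pzRingType) (M N : lmodType A) : Prop :=
  exists f : {linear M -> N}, bijective f.

Definition trivial_mod (A : pzRingType) (M : lmodType A) : Prop :=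
  forall x : M, x = 0.

Definition indecomposable (A : pzRingType) (M : lmodType A) : Prop :=
  ~ trivial_mod M /\
  forall X Y : lmodType A, mod_iso M (X * Y)%type ->
    trivial_mod X \/ trivial_mod Y.

(* [{ffun 'I_n -> V}] is the direct sum of [n] copies of [V]. *)
Definition in_add (A : pzRingType) (V X : lmodType A) : Prop :=
  exists (n : nat) (Y : lmodType A), mod_iso {ffun 'I_n -> V} (X * Y)%type.

Definition finite_rep_type (C : pzRingType) : Prop :=
  exists (n : nat) (M : 'I_n -> lmodType C),
    forall X : lmodType C, fin_gen X -> indecomposable X ->
      exists i, mod_iso X (M i).

Definition additive_generator (C : pzRingType) (V : lmodType C) : Prop :=
  fin_gen V /\ forall X : lmodType C, fin_gen X -> in_add V X.

Definition surjective (S T : Type) (f : S -> T) : Prop :=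
  forall y, exists x, f x = y.

Definition projective (A : pzRingType) (P : lmodType A) : Prop :=
  forall (M N : lmodType A) (g : {linear M -> N}) (h : {linear P -> N}),
    surjective g -> exists k : {linear P -> M}, forall x, g (k x) = h x.

Definition superfluous (A : pzRingType) (P : lmodType A) (K : {pred P}) : Prop :=
  forall N : {pred P}, submod_closed N ->
    (forall x, exists y z, [/\ y \in N, z \in K & x = y + z]) -> N =i predT.

Definition projective_cover (A : pzRingType) (P X : lmodType A)
    (p : {linear P -> X}) : Prop :=
  [/\ projective P, surjective p & superfluous (ker_pred p)].

Definition short_exact (A : pzRingType) (M1 M0 N : lmodType A)
    (f : {linear M1 -> M0}) (g : {linear M0 -> N}) : Prop :=
  [/\ injective f, forall y, g y = 0 <-> exists x, f x = y & surjective g].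

(* The syzygy of [Y] is [ker_mod q] for a projective cover [q] of [Y]; it is
   unique up to isomorphism, and the condition ranges over all choices of [q].
   Witnesses are finitely generated, as are all modules considered. *)
Definition one_Igusa_Todorov_witness (A : pzRingType) (W : lmodType A) : Prop :=
  fin_gen W /\
  forall Y : lmodType A, fin_gen Y ->
  forall (Q : lmodType A) (q : {linear Q -> Y}), projective_cover q ->
  exists (W1 W0 : lmodType A) (f : {linear W1 -> W0})
         (g : {linear W0 -> ker_mod q}),
    [/\ in_add W W1, in_add W W0 & short_exact f g].

(* Main.v *)
Require Import Defs.
From HB Require Import structures.
From mathcomp Require Import all_boot all_algebra.
From mathcomp Require Import boolp.

Set Implicit Arguments.
Unset Strict Implicit.
Unset Printing Implicit Defensive.

Import GRing.Theory.
Local Open Scope ring_scope.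

(** Let [J] be the radical and [X] the syzygy of [Y], a submodule of the
    projective cover [Q]. Because [X] is superfluous, it lies in [J Q]
    ([superfluous_sub_jrad]), so [J ^ (2 m + 1) = 0] makes [J ^ (2 m)] kill [X].
    Hence both [J ^ m X] and [Z = X / J ^ m X] are killed by [J ^ m]; they are
    modules over [A / J ^ m] and belong to [add V].

    To turn the extension [0 -> J ^ m X -> X -> Z -> 0] into a resolution of [X]
    by [add W], choose a surjection [l] from a finitely generated free module
    [F] onto [X], with composite [F -> Z]. Adding [l] to the inclusion of
    [J ^ m X] gives an exact sequence
        [0 -> ker (F -> Z) -> J ^ m X * F -> X -> 0]
    ([ker_comp_short_exact]). Its middle term is in [add (V * A)]. The kernel of
    [F -> Z] is a syzygy of a module in [add V] computed with a free module
    instead of a projective cover; comparing it with [p : P -> V] as in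
    Schanuel's lemma shows that it lies in [add (ker p * A)] ([id_factors_ker]).

    All of this stays among finitely generated modules because [A] is left
    Noetherian. That is the Hopkins-Levitzki argument: [A] is left Artinian, so
    [A / J] is semisimple ([jrad_semisimple_decomposition]), an Artinian module
    [M] is finitely generated modulo [J M] ([dcc_semisimple_fin_gen]), hence
    finitely generated because [J] is nilpotent ([span_over_ideal_exp]).

    Membership in [add W] is handled as a factorisation of the identity through
    powers of [W] ([id_factors]), which never requires naming a complement. *)

(** * Submodules and spans *)

Section SubmodClosed.
Variables (A : pzRingType) (M : lmodType A) (N : {pred M}).
Hypothesis NC : submod_closed N.

Lemma submod_mem0 : 0 \in N. Proof. by case: NC. Qed.

Lemma submod_memZ a x : x \in N -> a *: x \in N.
Proof. by case: NC => N0 NL xN; rewrite -[_ *: _]addr0 NL. Qed.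

Lemma submod_memD x y : x \in N -> y \in N -> x + y \in N.
Proof. by case: NC => _ NL xN yN; rewrite -[x]scale1r NL. Qed.

Lemma submod_memB x y : x \in N -> y \in N -> x - y \in N.
Proof.
move=> xN yN; rewrite -scaleN1r.
by apply: submod_memD => //; apply: submod_memZ.
Qed.

Lemma submod_sum (I : Type) (r : seq I) (F : I -> M) :
  (forall i, F i \in N) -> \sum_(i <- r) F i \in N.
Proof.
move=> FN; elim/big_rec: _ => [|i x _ xN]; first exact: submod_mem0.
exact: submod_memD.
Qed.

End SubmodClosed.

Lemma submod_closed0 (A : pzRingType) (M : lmodType A) :
  submod_closed (pred1 (0 : M)).
Proof.
split=> [|a x y]; rewrite !inE // => /eqP-> /eqP->.
by rewrite scaler0 addr0.
Qed.

(** Membership in [B + A s]. Keeping the submodule [B] as a base lets the same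
    induction on [s] serve generation of a module and generation modulo a
    submodule. *)
Fixpoint span_over (A : pzRingType) (M : lmodType A) (B : {pred M})
    (s : seq M) (x : M) : Prop :=
  if s is e :: s' then exists a, span_over B s' (x - a *: e) else x \in B.

Section Span.
Variables (A : pzRingType) (M : lmodType A) (B : {pred M}).
Hypothesis BC : submod_closed B.

Lemma span_over_base s x : x \in B -> span_over B s x.
Proof.
by move=> xB; elim: s => //= e s IHs; exists 0; rewrite scale0r subr0.
Qed.

Lemma span_over_cons e s x : span_over B s x -> span_over B (e :: s) x.
Proof. by exists 0; rewrite scale0r subr0. Qed.

Lemma span_over_lin s a x y :
  span_over B s x -> span_over B s y -> span_over B s (a *: x + y).
Proof.
elim: s x y => [|e s IHs] x y /=; first by case: BC => _; apply.
move=> [b xb] [c yc]; exists (a * b + c).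
suff -> : a *: x + y - (a * b + c) *: e = a *: (x - b *: e) + (y - c *: e).
  exact: IHs.
by rewrite scalerBr scalerDl opprD scalerA addrACA.
Qed.

Lemma span_over_add s x y :
  span_over B s x -> span_over B s y -> span_over B s (x + y).
Proof. by move=> xs ys; rewrite -[x]scale1r; apply: span_over_lin. Qed.

Lemma span_over_scale s a x : span_over B s x -> span_over B s (a *: x).
Proof.
move=> xs; rewrite -[_ *: _]addr0; apply: span_over_lin => //.
exact: span_over_base (submod_mem0 BC).
Qed.

Lemma span_over_mem s e : e \in s -> span_over B s e.
Proof.
elim: s => // d s IHs; rewrite inE => /predU1P[-> | /IHs]; last first.
  exact: span_over_cons.
exists 1; rewrite scale1r subrr; exact: span_over_base (submod_mem0 BC).
Qed.

Lemma span_over_sum (I : Type) (r : seq I) (F : I -> M) s :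
  (forall i, span_over B s (F i)) -> span_over B s (\sum_(i <- r) F i).
Proof.
move=> Fs; elim/big_rec: _ => [|i x _ xs]; last exact: span_over_add.
exact: span_over_base (submod_mem0 BC).
Qed.

End Span.

Lemma span_over_trans (A : pzRingType) (M : lmodType A) (B B' : {pred M})
    (s t : seq M) x :
    submod_closed B' -> {in t, forall e, span_over B' s e} ->
  {in B, forall b, span_over B' s b} -> span_over B t x -> span_over B' s x.
Proof.
move=> B'C + sB; elim: t x => [|e t IHt] x ts /=; first exact: sB.
case=> a xt; rewrite -[x](subrK (a *: e)); apply: span_over_add => //.
  by apply: IHt => // y yt; apply: ts; rewrite inE yt orbT.
by apply: span_over_scale => //; apply: ts; rewrite mem_head.
Qed.

Lemma fin_gen_fin (A : pzRingType) (M : lmodType A) (I : finType)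
    (e : I -> M) :
  (forall x, exists c : I -> A, x = \sum_i c i *: e i) -> fin_gen M.
Proof.
move=> egen; exists #|I|, (e \o enum_val) => x.
have [c ->] := egen x; exists (c \o enum_val).
by rewrite (reindex _ (onW_bij _ (@enum_val_bij I))).
Qed.

Lemma fin_gen_span (A : pzRingType) (M : lmodType A) :
  fin_gen M <-> exists s, forall x : M, span_over (pred1 0) s x.
Proof.
split=> [[n [e egen]]|[s sgen]].
  exists (map e (enum 'I_n)) => x; have [c ->] := egen x.
  apply: span_over_sum => [|i]; first exact: submod_closed0.
  apply/span_over_scale/span_over_mem; try exact: submod_closed0.
  by apply: map_f; rewrite mem_enum.
have coef x : span_over (pred1 0) s x ->
    exists c : nat -> A, x = \sum_(i < size s) c i *: s`_i.
  elim: s {sgen} x => [|e s IHs] x /=.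
    by move/eqP->; exists (fun=> 0); rewrite big_ord0.
  case=> a /IHs[c xc]; exists (fun i => if i is j.+1 then c j else a).
  by rewrite big_ord_recl /= -xc addrC subrK.
exists (size s), (fun i => s`_i) => x.
by have [c ->] := coef x (sgen x); exists c.
Qed.

(** * Artinian modules *)

Definition dcc (A : pzRingType) (M : lmodType A) : Prop :=
  forall N : nat -> {pred M}, (forall n, submod_closed (N n)) ->
    (forall n, {subset N n.+1 <= N n}) ->
  exists n, forall k, (n <= k)%N -> {subset N n <= N k}.

Lemma chain_subset (T : Type) (N : nat -> {pred T}) n k :
  (forall n, {subset N n.+1 <= N n}) -> (n <= k)%N -> {subset N k <= N n}.
Proof.
move=> Ndec; elim: k => [|k IHk]; first by rewrite leqn0 => /eqP->.
rewrite leq_eqVlt => /predU1P[-> // | /IHk nk x /Ndec]; exact: nk.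
Qed.

(** If every member had a strictly smaller one, iterating a choice of it would
    give a descending chain that never stabilises. *)
Lemma dcc_minimal (A : pzRingType) (M : lmodType A)
    (P : {pred M} -> Prop) (N0 : {pred M}) :
    dcc M -> (forall N, P N -> submod_closed N) -> P N0 ->
  exists2 N, P N & forall N', P N' -> {subset N' <= N} -> {subset N <= N'}.
Proof.
move=> Mdcc PC PN0; apply: contrapT => nomin.
have smaller (N : {N | P N}) : exists N' : {N | P N},
    {subset sval N' <= sval N} /\ ~ {subset sval N <= sval N'}.
  apply: contrapT => no; apply: nomin; exists (sval N); first exact: svalP.
  move=> N' PN' N'N; apply: contrapT => nNN'; apply: no.
  by exists (exist P N' PN').
have [f fP] := choice smaller.
pose F n := iter n f (exist P N0 PN0).
have [n nP] : exists n, forall k, (n <= k)%N ->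
    {subset sval (F n) <= sval (F k)}.
  apply: Mdcc => n; first by apply: PC; apply: svalP.
  by have [] := fP (F n).
by have [_] := fP (F n); apply; apply: nP n.+1 (leqnSn n).
Qed.

Lemma dcc_inj (A : pzRingType) (M N : lmodType A) (f : {linear N -> M}) :
  injective f -> dcc M -> dcc N.
Proof.
move=> f_inj Mdcc K KC Kdec.
pose L n : {pred M} := fun x => `[< exists2 y, y \in K n & x = f y >].
have [||n nP] := Mdcc L.
- move=> n; split=> [|a x y /asboolP[u uK ->] /asboolP[v vK ->]]; apply/asboolP.
    by exists 0; rewrite ?linear0 // (submod_mem0 (KC n)).
  by exists (a *: u + v); rewrite ?linearP //; case: (KC n) => _; apply.
- by move=> n x /asboolP[y yK ->]; apply/asboolP; exists y => //; apply: Kdec.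
exists n => k nk x xK.
have /asboolP[y yK /f_inj->//] : f x \in L k.
by apply: nP => //; apply/asboolP; exists x.
Qed.

(** Along a descending chain [N k] and for a generator [e] adjoined to a list
    [s], the coefficients of [e] in elements of [N k] lying in the span of
    [e :: s] form a descending chain of left ideals; once it and the chain of
    the [N k] cut by the span of [s] are stable, so is the chain cut by the
    span of [e :: s]. *)
Lemma dcc_fin_gen (A : pzRingType) (M : lmodType A) :
  dcc A^o -> fin_gen M -> dcc M.
Proof.
move=> Adcc /fin_gen_span[s sgen] N NC Ndec.
have BC := submod_closed0 M.
suff [n nP] : exists n, forall k, (n <= k)%N -> forall x,
    span_over (pred1 0) s x -> x \in N n -> x \in N k.
  by exists n => k nk x; apply: nP.
elim: s {sgen} => [|e s [n1 n1P]].
  by exists 0%N => k _ x /eqP-> _; apply: (submod_mem0 (NC k)).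
pose I k : {pred A^o} := fun a : A =>
  `[< exists2 r, span_over (pred1 0) s r & a *: e + r \in N k >].
have [||n2 n2P] := Adcc I.
- move=> k; split=> [|a b c /asboolP[r rs br] /asboolP[t ts ct]]; apply/asboolP.
    exists 0; first exact: span_over_base (submod_mem0 BC).
    by rewrite scale0r addr0 (submod_mem0 (NC k)).
  exists (a *: r + t); first exact: span_over_lin.
  rewrite scalerDl -scalerA addrACA -scalerDr.
  by case: (NC k) => _; apply.
- move=> k a /asboolP[r rs ar]; apply/asboolP; exists r => //; exact: Ndec.
exists (maxn n1 n2) => k; rewrite geq_max => /andP[n1k n2k] x [a xs] xN.
have xN' : forall n, (n <= maxn n1 n2)%N -> x \in N n.
  by move=> n nm; apply: (chain_subset Ndec nm).
have /asboolP[r rs ar] : a \in I k.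
  apply: (n2P k n2k); apply/asboolP; exists (x - a *: e) => //.
  by rewrite addrC subrK xN' ?leq_maxr.
rewrite -[x](subrK (a *: e + r)); apply: (submod_memD (NC k)) => //.
apply: (n1P k n1k).
  rewrite opprD addrA -[- r]scaleN1r addrC; exact: span_over_lin.
apply: (submod_memB (NC n1)); first by rewrite xN' ?leq_maxl.
exact: (chain_subset Ndec n1k).
Qed.

(** * Artinian modules are finitely generated modulo the radical *)

(** The image of [u] modulo [B] is zero or generates a simple module. *)
Definition simple_over (A : pzRingType) (M : lmodType A) (B : {pred M})
    (u : M) : Prop :=
  forall a, a *: u \in B \/ exists c, u - c *: (a *: u) \in B.

(** If no finite list spans modulo [B], one finds [u 0, u 1, ...], each
    simple over [B] and outside the span of its predecessors. The submodules
    generated by [B] and the tails of this sequence descend, so some [u n] lies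
    in the span of its successors; the last successor with a nonzero
    contribution is then in the span of its predecessors, a contradiction. *)
Lemma dcc_semisimple_fin_gen (A : pzRingType) (M : lmodType A)
    (B : {pred M}) :
    dcc M -> submod_closed B ->
    (forall x, exists2 s, {in s, forall u, simple_over B u} &
      span_over B s x) ->
  exists s, forall x, span_over B s x.
Proof.
move=> Mdcc BC Bss; apply: contrapT => nfg.
have indep (s : seq M) : exists u, simple_over B u /\ ~ span_over B s u.
  apply: contrapT => no; apply: nfg; exists s => x; have [t tB] := Bss x.
  apply: span_over_trans => // [u /tB uB|b]; last exact: span_over_base.
  by apply: contrapT => us; apply: no; exists u.
have [f fP] := choice indep.
pose prev n := iter n (fun s => f s :: s) [::].
pose u n := f (prev n).
have uB n : simple_over B (u n) by case: (fP (prev n)).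
have uN n : ~ span_over B (prev n) (u n) by case: (fP (prev n)).
pose seg n k := iteri k (fun i s => u (n + i)%N :: s) [::].
pose T n : {pred M} := fun x => `[< exists k, span_over B (seg n k) x >].
have seg_mono n k l x : (k <= l)%N ->
    span_over B (seg n k) x -> span_over B (seg n l) x.
  move=> kl xk; rewrite -(subnK kl); elim: (l - k)%N => // i IHi.
  exact: span_over_cons IHi.
have seg_shift n k x :
    span_over B (seg n.+1 k) x -> span_over B (seg n k.+1) x.
  elim: k x => [|k IHk] x; first exact: span_over_base.
  by case=> a /IHk xk; exists a; rewrite addnS -addSn.
have [||n nP] := Mdcc T.
- move=> n; split=> [|a x y /asboolP[k xk] /asboolP[l yl]]; apply/asboolP.
    by exists 0%N; exact: (submod_mem0 BC).
  exists (maxn k l); apply: span_over_lin => //.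
    by apply: seg_mono xk; rewrite leq_maxl.
  by apply: seg_mono yl; rewrite leq_maxr.
- move=> n x /asboolP[k xk]; apply/asboolP; exists k.+1; exact: seg_shift.
have /asboolP[k uk] : u n \in T n.+1.
  apply: nP => //; apply/asboolP; exists 1%N; exists 1.
  rewrite addn0 scale1r subrr; exact: (submod_mem0 BC).
have seg_prev l i x : span_over B (seg l i) x -> span_over B (prev (l + i)%N) x.
  elim: i x => [|i IHi] x; first exact: span_over_base.
  by rewrite addnS; case=> a /IHi xi; exists a.
(* The first alternative of [simple_over] lets the last successor be dropped;
   the second puts it in the span of its predecessors. *)
have exch i x : span_over B (prev n.+1) x -> span_over B (seg n.+1 i) x ->
    x \in B.
  elim: i x => [|i IHi] x xp //; case=> a xi.
  have [auB | [c cuB]] := uB (n.+1 + i)%N a.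
    apply: IHi => //; rewrite -[x](subrK (a *: u (n.+1 + i)%N)).
    by apply: span_over_add => //; apply: span_over_base.
  have prev_mono : span_over B (prev (n.+1 + i)%N) x.
    elim: {xi IHi cuB} i => [|i IHi]; first by rewrite addn0.
    by rewrite addnS; apply: span_over_cons.
  case: (uN (n.+1 + i)%N); rewrite -[u _](subrK (c *: (a *: u (n.+1 + i)%N))).
  apply: span_over_add => //; first exact: span_over_base.
  apply: span_over_scale => //; rewrite -[a *: _](subKr x).
  rewrite -scaleN1r addrC; apply: span_over_lin => //; exact: seg_prev.
case: (uN n); apply: span_over_base => //; apply: exch uk.
by apply: span_over_mem => //; apply: mem_head.
Qed.

Lemma maximal_left_ideal_comax (A : pzRingType) (M : {pred A}) (a x : A) :
  maximal_left_ideal M -> a \notin M -> exists c, x - c * a \in M.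
Proof.
move=> [MC M1 Mmax] aM.
pose N : {pred A} := fun y => `[< exists c, y - c * a \in M >].
suff /asboolP[c cM] : 1 \in N.
  by exists (x * c); rewrite -{1}[x]mulr1 -mulrA -mulrBr (submod_memZ MC x cM).
apply: contraT => N1; case/negP: aM; rewrite -(Mmax N) //.
- by apply/asboolP; exists 1; rewrite mul1r subrr (submod_mem0 MC).
- split=> [|b y z /asboolP[c cM] /asboolP[d dM]]; apply/asboolP.
    by exists 0; rewrite mul0r subr0 (submod_mem0 MC).
  exists (b * c + d).
  suff -> : b *: (y : A^o) + z - (b * c + d) * a
      = b *: (y - c * a : A^o) + (z - d * a).
    by case: MC => _; apply.
  by rewrite scalerBr mulrDl opprD -mulrA addrACA.
- by move=> y yM; apply/asboolP; exists 0; rewrite mul0r subr0.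
Qed.

Lemma ideal_submod_closed (A : pzRingType) (I : twoSidedIdeal A) :
  submod_closed (I : {pred A^o}).
Proof.
split=> [|a x y xI yI]; first exact: rpred0.
by apply: rpredD => //; apply: idealMl.
Qed.

(** The left ideals [I] over which [1] decomposes into simple elements in this
    way include the whole ring and are stable under intersection with a maximal
    left ideal [M]: if [b] lies in [I] and not in [M], then [I / (I :&: M)] is
    simple and generated by [b], and subtracting multiples of [b] moves any
    other element into [M]. A minimal one therefore lies in every maximal left
    ideal. *)
Lemma jrad_semisimple_decomposition (A : pzRingType) :
    dcc A^o ->
  exists2 s : seq A^o, {in s, forall u, simple_over (jrad A : {pred A^o}) u} &
    span_over (jrad A : {pred A^o}) s 1.
Proof.
move=> Adcc.
have JC := ideal_submod_closed (jrad A).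
pose P (I : {pred A^o}) := [/\ submod_closed I, {subset jrad A <= I} &
  exists2 s : seq A^o, {in s, forall u, simple_over I u} & span_over I s 1].
have [||I [IC JI [s sI s1]] Imin] := @dcc_minimal A A^o P predT Adcc.
- by move=> I; case.
- by split=> //; exists [::].
suff IJ : {subset I <= jrad A}.
  have eqIJ : I =i jrad A by move=> x; apply/idP/idP; [apply: IJ | apply: JI].
  exists s => [u us a|].
    have := sI u us a; rewrite eqIJ => -[|[c]]; [by left | right].
    by exists c; rewrite -eqIJ.
  apply: span_over_trans s1 => // [u us|b /IJ bJ]; first exact: span_over_mem.
  exact: span_over_base.
move=> b bI; apply/asboolP => M Mmax; apply: contraT => bM.
have MC : submod_closed (M : {pred A^o}) by case: Mmax.
pose IM : {pred A^o} := [pred x | (x \in I) && (x \in M)].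
have IMC : submod_closed IM.
  split=> [|a x y]; rewrite !inE.
    by rewrite (submod_mem0 IC) (submod_mem0 MC).
  case: IC MC => _ IL [_ ML] /andP[xI xM] /andP[yI yM].
  by rewrite IL ?ML.
suff PIM : P IM.
  have /andP[] := Imin _ PIM (fun x xIM => proj1 (andP xIM)) b bI.
  by rewrite (negPf bM).
have bIM x : x \in I -> exists c, x - c *: b \in IM.
  move=> xI; have [c cM] := maximal_left_ideal_comax x Mmax bM.
  by exists c; rewrite inE cM andbT (submod_memB IC) ?(submod_memZ IC).
have comax (u : A^o) : exists c, u - c *: b \in M.
  exact: maximal_left_ideal_comax.
have [t tP] := choice comax.
pose adj u := u - t u *: b.
have adjI u : u - adj u \in I.
  by rewrite subKr; apply: submod_memZ.
split=> //.
  by move=> x xJ; rewrite inE JI //=; move/asboolP: xJ; apply.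
exists (b :: map adj s).
  move=> u; rewrite inE => /predU1P[-> | /mapP[e es ->]] a.
    have [abM | abM] := boolP (a *: b \in M).
      by left; rewrite inE abM andbT; apply: submod_memZ.
    have [c cM] := maximal_left_ideal_comax b Mmax abM.
    right; exists c.
    by rewrite inE cM andbT (submod_memB IC) ?(submod_memZ IC).
  have adjM : adj e \in M := tP e.
  have [aeI | [c cI]] := sI e es a; [left | right; exists c]; rewrite inE.
    rewrite (submod_memZ MC) // andbT -[adj e](subKr e) scalerBr.
    by apply: (submod_memB IC) => //; apply: (submod_memZ IC); apply: adjI.
  rewrite (submod_memB MC) ?(submod_memZ MC) // andbT.
  suff -> : adj e - c *: (a *: adj e)
      = (e - c *: (a *: e)) - (t e *: b - c *: (a *: (t e *: b))).
    by rewrite (submod_memB IC) // (submod_memB IC) ?(submod_memZ IC).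
  rewrite !scalerBr !opprB addrACA [RHS]addrACA; congr (_ + _).
  by rewrite addrC.
apply: span_over_trans s1 => // [e es|x xI].
  rewrite -[e](subrK (t e *: b)); apply: span_over_add => //.
    by apply: span_over_mem => //; rewrite inE (map_f adj es) orbT.
  by apply/span_over_scale/span_over_mem; rewrite ?mem_head.
have [c xcM] := bIM x xI; rewrite -[x](subrK (c *: b)).
apply: span_over_add => //; first exact: span_over_base.
by apply/span_over_scale/span_over_mem; rewrite ?mem_head.
Qed.

Definition ideal_smul (A : pzRingType) (I : {pred A}) (M : lmodType A) :
    {pred M} :=
  fun x => `[< exists s : seq (A * M), {in s, forall u, u.1 \in I} /\
    x = \sum_(u <- s) u.1 *: u.2 >].
Arguments ideal_smul {A} I M.

Section IdealSmul.
Variables (A : pzRingType) (I : twoSidedIdeal A) (M : lmodType A).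

Lemma ideal_smul_gen a (x : M) : a \in I -> a *: x \in ideal_smul I M.
Proof.
move=> aI; apply/asboolP; exists [:: (a, x)]; rewrite big_seq1.
by split=> // u; rewrite inE => /eqP->.
Qed.

Lemma ideal_smul_closed : submod_closed (ideal_smul I M).
Proof.
split=> [|a x y /asboolP[s [sI ->]] /asboolP[t [tI ->]]]; apply/asboolP.
  by exists [::]; rewrite big_nil.
exists ([seq (a * u.1, u.2) | u <- s] ++ t); split=> [u|].
  by rewrite mem_cat => /orP[/mapP[v /sI vI ->]|/tI//]; apply: idealMl.
rewrite big_cat big_map scaler_sumr; congr (_ + _).
by apply: eq_bigr => u _; rewrite scalerA.
Qed.

Lemma ideal_smul_ind (N : {pred M}) :
    submod_closed N -> (forall a x, a \in I -> a *: x \in N) ->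
  {subset ideal_smul I M <= N}.
Proof.
move=> NC IN x /asboolP[s [sI ->]]; elim: s sI => [|u s IHs] sI.
  by rewrite big_nil (submod_mem0 NC).
rewrite big_cons (submod_memD NC) //; first by rewrite IN ?sI ?mem_head.
by apply: IHs => v vs; rewrite sI // inE vs orbT.
Qed.

Lemma ideal_smul_annihilated (K : twoSidedIdeal A) :
    (forall d a (x : M), d \in K -> a \in I -> d *: (a *: x) = 0) ->
  forall d x, d \in K -> x \in ideal_smul I M -> d *: x = 0.
Proof.
move=> KI d x dK xI.
pose N : {pred M} := fun y => `[< forall c, c \in K -> c *: y = 0 >].
suff /asboolP : x \in N by apply.
apply: ideal_smul_ind xI => [|a y aI]; last first.
  by apply/asboolP => c cK; apply: KI.
split=> [|a y z /asboolP yN /asboolP zN]; apply/asboolP => c cK.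
  by rewrite scaler0.
by rewrite scalerDr scalerA yN ?zN ?addr0 //; apply: Defs.idealMr.
Qed.

End IdealSmul.

Lemma dcc_fin_gen_mod_jrad (A : pzRingType) (M : lmodType A) :
    dcc A^o -> dcc M ->
  exists s, forall x, span_over (ideal_smul (jrad A) M) s x.
Proof.
move=> Adcc Mdcc; have JMC := ideal_smul_closed (jrad A) M.
apply: dcc_semisimple_fin_gen => // x.
have [s sJ s1] := jrad_semisimple_decomposition Adcc.
exists [seq (u : A) *: x | u <- s].
  move=> _ /mapP[u us ->] a; rewrite scalerA.
  have [auJ | [c cJ]] := sJ u us a; [left | right; exists c].
    exact: ideal_smul_gen.
  by rewrite scalerA -scalerBl; apply: ideal_smul_gen.
suff spanx c : span_over (jrad A : {pred A^o}) s c ->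
    span_over (ideal_smul (jrad A) M) [seq (u : A) *: x | u <- s]
      ((c : A) *: x).
  by have := spanx 1 s1; rewrite scale1r.
elim: s c {sJ s1} => [|u s IHs] c /=; first exact: ideal_smul_gen.
by case=> a /IHs cs; exists a; rewrite scalerA -scalerBl.
Qed.

(** * Powers of an ideal *)

Lemma ideal_exp1 (A : pzRingType) (I : twoSidedIdeal A) a :
  a \in I -> a \in ideal_exp I 1.
Proof.
move=> aI; apply/asboolP; exists [:: (a, 1)]; rewrite big_seq1 mulr1.
by split=> // u; rewrite inE => /eqP->.
Qed.

Lemma ideal_expM (A : pzRingType) (I : twoSidedIdeal A) k n a b :
  a \in ideal_exp I k -> b \in ideal_exp I n -> a * b \in ideal_exp I (k + n).
Proof.
elim: k a => [|k IHk] a aI bI; first exact: idealMl.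
have /asboolP[s [sI ->]] := aI; apply/asboolP.
exists [seq (u.1, u.2 * b) | u <- s]; split=> [u /mapP[v /sI[v1 v2] ->]|].
  by split=> //; apply: IHk.
by rewrite big_map mulr_suml; apply: eq_bigr => u _; rewrite mulrA.
Qed.

(** Substituting [M = I M + A s] into itself gives [M = I ^ n M + A s]. *)
Lemma span_over_ideal_exp (A : pzRingType) (I : twoSidedIdeal A)
    (M : lmodType A) (s : seq M) n :
    (forall x, span_over (ideal_smul I M) s x) ->
  forall x, span_over (ideal_smul (ideal_exp I n) M) s x.
Proof.
move=> sI; elim: n => [|n IHn] x.
  apply: span_over_base; rewrite -[x]scale1r.
  exact: (ideal_smul_gen (I := ideal_exp I 0)).
have JC := ideal_smul_closed (ideal_exp I n.+1) M.
have mulI t y a : a \in I -> span_over (ideal_smul (ideal_exp I n) M) t y ->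
    span_over (ideal_smul (ideal_exp I n.+1) M) t (a *: y).
  elim: t y => [|e t IHt] y aI /=; last first.
    by case=> b /(IHt _ aI) ys; exists (a * b); rewrite -scalerA -scalerBr.
  (* Quantifying over all scalars in [I] makes this a submodule even though [A]
     is not commutative. *)
  pose N : {pred M} := fun y =>
    `[< forall a, a \in I -> a *: y \in ideal_smul (ideal_exp I n.+1) M >].
  suff NI : {subset ideal_smul (ideal_exp I n) M <= N}.
    by move=> /NI/asboolP; apply.
  apply: ideal_smul_ind => [|c z cI]; last first.
    apply/asboolP => b bI; rewrite scalerA; apply: ideal_smul_gen.
    by rewrite -add1n ideal_expM ?ideal_exp1.
  split=> [|c z w /asboolP zN /asboolP wN]; apply/asboolP => b bI.
    by rewrite scaler0 (submod_mem0 JC).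
  rewrite scalerDr scalerA; apply: (submod_memD JC); last exact: wN.
  by apply: zN; apply: Defs.idealMr.
apply: span_over_trans (sI x) => // [u us|]; first exact: span_over_mem.
pose N : {pred M} := fun y =>
  `[< span_over (ideal_smul (ideal_exp I n.+1) M) s y >].
suff NI : {subset ideal_smul I M <= N} by move=> b /NI/asboolP.
apply: ideal_smul_ind => [|a y aI]; last by apply/asboolP/mulI.
split=> [|a y z /asboolP ys /asboolP zs]; apply/asboolP.
  exact: span_over_base (submod_mem0 JC).
exact: span_over_lin.
Qed.

(** * Finitely generated modules over an Artin algebra *)

(** Left ideals of [A] are [R]-submodules of the finitely generated [R]-module
    [A]. *)
Lemma dcc_artin_algebra (R : comPzRingType) (A : algType R) :
  artin_algebra A -> dcc A^o.
Proof.
case=> Rart Afg.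
have Rdcc : dcc R^o.
  move=> N NC Ndec; have [n nP] := Rart N NC Ndec.
  by exists n => k /nP eqN x; rewrite eqN.
move=> N NC; apply: (dcc_fin_gen Rdcc Afg) => n.
split=> [|a x y xN yN]; first exact: (submod_mem0 (NC n)).
by rewrite -[x]mul1r scalerAl; case: (NC n) => _; apply.
Qed.

Section NilpotentRadical.
Variables (A : pzRingType) (n : nat).
Hypotheses (Adcc : dcc A^o) (Jnil : ideal_exp (jrad A) n =i pred1 0).

Lemma dcc_is_fin_gen (M : lmodType A) : dcc M -> fin_gen M.
Proof.
move=> Mdcc; have [s sJ] := dcc_fin_gen_mod_jrad Adcc Mdcc.
apply/fin_gen_span; exists s => x.
have M0 := submod_closed0 M.
apply: span_over_trans (span_over_ideal_exp n sJ x) => // [u us|b].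
  exact: span_over_mem.
move=> bJ; apply: span_over_base => //; apply: ideal_smul_ind bJ => // a y.
by rewrite Jnil => /eqP->; rewrite scale0r inE.
Qed.

Lemma fin_gen_ker (M N : lmodType A) (f : {linear M -> N}) :
  fin_gen M -> fin_gen (ker_mod f).
Proof.
move=> Mfg; apply: dcc_is_fin_gen.
apply: (@dcc_inj A M (ker_mod f) (val : {linear ker_mod f -> M})) => //.
  exact: val_inj.
exact: dcc_fin_gen.
Qed.

End NilpotentRadical.

(** * Linear maps, quotients and modules over a quotient ring *)

Definition linear_map (A : pzRingType) (M N : lmodType A) (f : M -> N)
    (f_lin : linear f) : {linear M -> N} :=
  HB.pack f (GRing.isLinear.Build A M N *:%R f f_lin).

Section QuotMod.
Variables (A : pzRingType) (M : lmodType A) (S : {pred M}).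
Hypothesis SC : submod_closed S.

Lemma submod_zmod_closed : zmod_closed S.
Proof. by split=> [|x y]; [apply: submod_mem0 | apply: submod_memB]. Qed.

Definition submod_zmodClosed : zmodClosed M :=
  HB.pack (S : M -> bool) (GRing.isZmodClosed.Build M S submod_zmod_closed).
Local Notation quot := (Quotient.quot submod_zmodClosed).

Definition quot_mod : Type := quot.
HB.instance Definition _ := GRing.Zmodule.on quot_mod.

Definition quot_mod_proj (x : M) : quot_mod := \pi_quot%qT x.
Local Notation pr := quot_mod_proj.

Definition quot_mod_scale (a : A) (u : quot_mod) : quot_mod :=
  pr (a *: repr (u : quot)).

Lemma quot_mod_projP x y : reflect (pr x = pr y) (x - y \in S).
Proof.
have -> : (x - y \in S) = (pr x == pr y).
  exact: (Quotient.idealrBE submod_zmodClosed x y).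
exact: eqP.
Qed.

Lemma quot_mod_proj_surj : surjective pr.
Proof. by move=> u; exists (repr (u : quot)); apply: reprK. Qed.

Lemma quot_mod_projD x y : pr (x + y) = pr x + pr y.
Proof. exact: (raddfD (\pi_(quot)%qT)). Qed.

Lemma quot_mod_projZ a x : pr (a *: x) = quot_mod_scale a (pr x).
Proof.
apply/quot_mod_projP; rewrite -scalerBr; apply: submod_memZ => //.
by apply/quot_mod_projP; rewrite /pr reprK.
Qed.

Lemma quot_mod_scaleA a b u :
  quot_mod_scale a (quot_mod_scale b u) = quot_mod_scale (a * b) u.
Proof.
by have [x <-] := quot_mod_proj_surj u; rewrite -!quot_mod_projZ scalerA.
Qed.

Lemma quot_mod_scale1 : left_id 1 quot_mod_scale.
Proof.
move=> u; have [x <-] := quot_mod_proj_surj u.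
by rewrite -quot_mod_projZ scale1r.
Qed.

Lemma quot_mod_scaleDr : right_distributive quot_mod_scale +%R.
Proof.
move=> a u v; have [x <-] := quot_mod_proj_surj u.
have [y <-] := quot_mod_proj_surj v.
by rewrite -quot_mod_projD -!quot_mod_projZ scalerDr quot_mod_projD.
Qed.

Lemma quot_mod_scaleDl u : {morph quot_mod_scale^~ u : a b / a + b}.
Proof.
move=> a b; have [x <-] := quot_mod_proj_surj u.
by rewrite -!quot_mod_projZ scalerDl quot_mod_projD.
Qed.

HB.instance Definition _ := GRing.Zmodule_isLmodule.Build A quot_mod
  quot_mod_scaleA quot_mod_scale1 quot_mod_scaleDr quot_mod_scaleDl.

Lemma quot_mod_proj_linear : linear pr.
Proof. by move=> a x y; rewrite quot_mod_projD quot_mod_projZ. Qed.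

HB.instance Definition _ :=
  GRing.isLinear.Build A M quot_mod *:%R quot_mod_proj quot_mod_proj_linear.

End QuotMod.

(** A copy of [M] that carries its module structure over the quotient ring by
    an ideal [I] killing [M]. *)
Definition over_quot (A : pzRingType) (I : twoSidedIdeal A) (M : lmodType A)
    of (forall a (x : M), a \in I -> a *: x = 0) : Type := M.

Section OverQuot.
Variables (A : pzRingType) (I : twoSidedIdeal A) (M : lmodType A).
Hypothesis IM : forall a (x : M), a \in I -> a *: x = 0.
Local Notation N := (over_quot IM).
Local Notation pr := (ring_quot_proj I).

HB.instance Definition _ := GRing.Zmodule.on N.

Definition over_quot_scale (c : ring_quot I) (x : N) : N :=
  repr (c : Quotient.quot I) *: (x : M).

Lemma over_quot_scale_proj a (x : M) : over_quot_scale (pr a) x = a *: x.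
Proof.
apply/eqP; rewrite -subr_eq0 -scalerBl; apply/eqP/IM.
by apply/ring_quot_projP; rewrite /ring_quot_proj reprK.
Qed.

Lemma over_quot_scaleA c d x :
  over_quot_scale c (over_quot_scale d x) = over_quot_scale (c * d) x.
Proof.
have [a <-] := ring_quot_proj_surj c; have [b <-] := ring_quot_proj_surj d.
by rewrite -rmorphM !over_quot_scale_proj scalerA.
Qed.

Lemma over_quot_scale1 : left_id 1 over_quot_scale.
Proof. by move=> x; rewrite -(rmorph1 pr) over_quot_scale_proj scale1r. Qed.

Lemma over_quot_scaleDr : right_distributive over_quot_scale +%R.
Proof. by move=> c x y; apply: scalerDr. Qed.

Lemma over_quot_scaleDl x : {morph over_quot_scale^~ x : c d / c + d}.
Proof.
move=> c d; have [a <-] := ring_quot_proj_surj c.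
have [b <-] := ring_quot_proj_surj d.
by rewrite -rmorphD !over_quot_scale_proj scalerDl.
Qed.

HB.instance Definition _ := GRing.Zmodule_isLmodule.Build (ring_quot I) N
  over_quot_scaleA over_quot_scale1 over_quot_scaleDr over_quot_scaleDl.

Lemma fin_gen_over_quot : fin_gen M -> fin_gen N.
Proof.
move=> [n [e egen]]; exists n, e => x; have [c ->] := egen x.
exists (fun i => pr (c i)); apply: eq_bigr => i _.
by rewrite -over_quot_scale_proj.
Qed.

End OverQuot.

Lemma fin_gen_restrict (A : pzRingType) (I : twoSidedIdeal A)
    (V : lmodType (ring_quot I)) :
  fin_gen V -> fin_gen (restrict_scalars (ring_quot_proj I) V).
Proof.
move=> [n [e egen]]; exists n, e => x; have [c ->] := egen x.
have [a ac] := choice (fun i => ring_quot_proj_surj (c i)).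
exists a; apply: eq_bigr => i _; by rewrite -ac.
Qed.

Lemma fin_gen_surj (A : pzRingType) (M N : lmodType A) (f : {linear M -> N}) :
  surjective f -> fin_gen M -> fin_gen N.
Proof.
move=> f_surj [n [e egen]]; exists n, (f \o e) => y.
have [x <-] := f_surj y; have [c ->] := egen x; exists c.
by rewrite linear_sum; apply: eq_bigr => i _; rewrite linearZ.
Qed.

Lemma fin_gen_regular (A : pzRingType) : fin_gen A^o.
Proof.
exists 1%N, (fun=> 1) => x; exists (fun=> x).
by rewrite big_ord1 [LHS](esym (mulr1 _)).
Qed.

Lemma fin_gen_prod (A : pzRingType) (M N : lmodType A) :
  fin_gen M -> fin_gen N -> fin_gen (M * N)%type.
Proof.
move=> [k [e egen]] [n [f fgen]].
pose g (i : 'I_k + 'I_n) : M * N :=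
  match i with inl i => (e i, 0) | inr j => (0, f j) end.
apply: (@fin_gen_fin _ _ _ g) => -[x y].
have [c ->] := egen x; have [d ->] := fgen y.
exists (fun i => match i with inl i => c i | inr j => d j end).
rewrite big_sumType /=; apply: injective_projections => /=.
  rewrite !raddf_sum /= [X in _ = _ + X]big1 ?addr0 // => j _.
  by rewrite scaler0.
rewrite !raddf_sum /= [X in _ = X + _]big1 ?add0r // => j _.
by rewrite scaler0.
Qed.

(** * Projective modules *)

Section Free.
Variables (A : pzRingType) (n : nat) (M : lmodType A) (e : 'I_n -> M).

Definition free_eval (c : {ffun 'I_n -> A^o}) : M := \sum_i (c i : A) *: e i.

Lemma free_eval_linear : linear free_eval.
Proof.
move=> a c d; rewrite /free_eval scaler_sumr -big_split; apply: eq_bigr => i _.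
by rewrite !ffunE scalerDl scalerA.
Qed.

HB.instance Definition _ := GRing.isLinear.Build A {ffun 'I_n -> A^o} M *:%R
  free_eval free_eval_linear.

End Free.

Definition free_basis (A : pzRingType) n (i : 'I_n) : {ffun 'I_n -> A^o} :=
  [ffun j => (i == j)%:R].

Lemma free_basis_sum (A : pzRingType) n (c : {ffun 'I_n -> A^o}) :
  c = \sum_i (c i : A) *: free_basis A i.
Proof.
apply/ffunP => j; rewrite sum_ffunE (bigD1 j) //= big1 => [|i ij].
  by rewrite addr0 !ffunE eqxx [RHS]mulr1.
by rewrite !ffunE (negPf ij) [LHS]mulr0.
Qed.

Lemma free_projective (A : pzRingType) n : projective {ffun 'I_n -> A^o}.
Proof.
move=> M N g h g_surj.
have [e eP] := choice (fun i => g_surj (h (free_basis A i))).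
exists (free_eval e) => c; rewrite [in RHS](free_basis_sum c) !linear_sum.
by apply: eq_bigr => i _; rewrite !linearZ /= eP.
Qed.

Lemma fin_gen_free_surj (A : pzRingType) (M : lmodType A) :
  fin_gen M -> exists n (f : {linear {ffun 'I_n -> A^o} -> M}), surjective f.
Proof.
move=> [n [e egen]]; exists n, (free_eval e) => x; have [c ->] := egen x.
by exists [ffun i => c i]; apply: eq_bigr => i _; rewrite ffunE.
Qed.

(** Lifts of generators of [X] generate [P] up to the superfluous kernel. *)
Lemma fin_gen_projective_cover (A : pzRingType) (P X : lmodType A)
    (p : {linear P -> X}) :
  projective_cover p -> fin_gen X -> fin_gen P.
Proof.
move=> [_ p_surj p_sup] [n [e egen]].
have [f fP] := choice (fun i => p_surj (e i)).
pose N : {pred P} := fun x => `[< exists c, x = free_eval f c >].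
exists n, f => x.
suff /asboolP[c ->] : x \in N by exists c.
rewrite (p_sup N) // => [|y].
  split=> [|a y z /asboolP[c ->] /asboolP[d ->]]; apply/asboolP.
    by exists 0; rewrite linear0.
  by exists (a *: c + d); rewrite linearP.
have [c yc] := egen (p y); pose c' : {ffun 'I_n -> A^o} := [ffun i => c i].
exists (free_eval f c'), (y - free_eval f c'); split.
- by apply/asboolP; exists c'.
- rewrite -topredE /= /ker_pred linearB /= yc subr_eq0 linear_sum; apply/eqP.
  by apply: eq_bigr => i _; rewrite ffunE linearZ /= fP.
- by rewrite addrC subrK.
Qed.

(** A superfluous submodule [K] has superfluous image under any linear form, so
    linear forms map [K] into every maximal left ideal. As [P] is projective,
    [x] is the combination of generators of [P] whose coefficients are the
    values of linear forms at [x] (a dual basis). *)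
Lemma superfluous_sub_jrad (A : pzRingType) (P : lmodType A) (K : {pred P}) :
    projective P -> fin_gen P -> submod_closed K -> superfluous K ->
  {subset K <= ideal_smul (jrad A) P}.
Proof.
move=> Pproj Pfg KC Ksup x xK.
have [n [f f_surj]] := fin_gen_free_surj Pfg.
have [s sP] := Pproj _ _ f idfun f_surj.
have JC := ideal_smul_closed (jrad A) P.
have sJ i : s x i \in jrad A.
  apply/asboolP => M Mmax; apply: contraT => sM.
  have MC : submod_closed (M : {pred A^o}) by case: Mmax.
  pose N : {pred P} := [pred y | s y i \in M].
  suff : x \in N by rewrite inE (negPf sM).
  rewrite (Ksup N) // => [|y].
    split=> [|a y z]; rewrite !inE.
      by rewrite linear0 ffunE (submod_mem0 MC).
    by move=> yM zM; rewrite linearP !ffunE; case: MC => _; apply.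
  have [c cM] := maximal_left_ideal_comax (s y i) Mmax sM.
  exists (y - (c : A) *: x), ((c : A) *: x); split; last by rewrite subrK.
    by rewrite inE linearB linearZ !ffunE.
  exact: submod_memZ.
rewrite -[x]sP (free_basis_sum (s x)) linear_sum.
apply: submod_sum => // i; rewrite linearZ; exact: ideal_smul_gen.
Qed.

(** * Direct summands of direct sums of copies *)

(** The identity of [X] is a sum of maps factoring through [W]. This is
    membership of [X] in [add W], in a form whose closure properties are
    obtained by composing and collecting families of maps. *)
Definition id_factors (A : pzRingType) (W X : lmodType A) : Prop :=
  exists (I : finType) (i : I -> {linear X -> W}) (r : I -> {linear W -> X}),
    forall x, \sum_j r j (i j x) = x.

Lemma can_linear (A : pzRingType) (M N : lmodType A) (f : {linear M -> N})
    (g : N -> M) :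
  cancel f g -> cancel g f -> linear g.
Proof. by move=> fK gK a x y; apply: (can_inj fK); rewrite linearP !gK. Qed.

Section IdFactors.
Variable A : pzRingType.
Implicit Types P V F W X Y Z : lmodType A.

Lemma id_factors_retract W X (i : {linear X -> W}) (r : {linear W -> X}) :
  cancel i r -> id_factors W X.
Proof.
move=> iK; exists unit, (fun=> i), (fun=> r) => x.
by rewrite big_const card_unit /= addr0.
Qed.

Lemma id_factors_trans W X Y :
  id_factors W X -> id_factors X Y -> id_factors W Y.
Proof.
move=> [I [i [r ir]]] [J [j [s js]]].
exists (J * I)%type, (fun u => i u.2 \o j u.1), (fun u => s u.1 \o r u.2) => y.
rewrite -[RHS]js -(pair_bigA _ (fun a b => s a (r b (i b (j a y))))) /=.
by apply: eq_bigr => a _; rewrite -linear_sum ir.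
Qed.

Lemma inl_linear X Y : linear (fun x : X => (x, 0) : X * Y).
Proof.
by move=> a x y; apply: injective_projections; rewrite /= ?scaler0 ?addr0.
Qed.

Lemma inr_linear X Y : linear (fun y : Y => (0, y) : X * Y).
Proof.
by move=> a x y; apply: injective_projections; rewrite /= ?scaler0 ?addr0.
Qed.

Lemma fst_linear X Y : linear (fst : X * Y -> X). Proof. by []. Qed.
Lemma snd_linear X Y : linear (snd : X * Y -> Y). Proof. by []. Qed.

Lemma id_factors_fst X Y : id_factors (X * Y)%type X.
Proof.
exact: (@id_factors_retract _ _ (linear_map (@inl_linear X Y))
  (linear_map (@fst_linear X Y))).
Qed.

Lemma id_factors_snd X Y : id_factors (X * Y)%type Y.
Proof.
exact: (@id_factors_retract _ _ (linear_map (@inr_linear X Y))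
  (linear_map (@snd_linear X Y))).
Qed.

Lemma id_factors_prod W X Y :
  id_factors W X -> id_factors W Y -> id_factors W (X * Y)%type.
Proof.
move=> [I [i [r ir]]] [J [j [s js]]].
pose inX := linear_map (@inl_linear X Y).
pose inY := linear_map (@inr_linear X Y).
pose prX := linear_map (@fst_linear X Y).
pose prY := linear_map (@snd_linear X Y).
exists (I + J)%type,
  (fun u => match u with inl a => i a \o prX | inr b => j b \o prY end
     : {linear _ -> _}),
  (fun u => match u with inl a => inX \o r a | inr b => inY \o s b end
     : {linear _ -> _}) => -[x y].
rewrite big_sumType /=.
rewrite -[LHS]/(\sum_a inX (r a (i a x)) + \sum_b inY (s b (j b y))).
rewrite -!linear_sum ir js; apply: injective_projections.
  exact: addr0.
exact: add0r.
Qed.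

Lemma ffun_single_linear X n (k : 'I_n) :
  linear (fun x : X => [ffun l => if k == l then x else 0] : {ffun 'I_n -> X}).
Proof.
move=> a x y; apply/ffunP => l; rewrite !ffunE.
by case: ifP => _ //; rewrite scaler0 addr0.
Qed.

Lemma ffun_eval_linear X n (k : 'I_n) :
  linear (fun f : {ffun 'I_n -> X} => f k).
Proof. by move=> a f g; rewrite !ffunE. Qed.

Lemma id_factors_ffun X n : id_factors X {ffun 'I_n -> X}.
Proof.
exists 'I_n, (fun k => linear_map (@ffun_eval_linear X n k)),
  (fun k => linear_map (@ffun_single_linear X n k)) => f.
apply/ffunP => l; rewrite sum_ffunE (bigD1 l) //= big1 => [|k kl].
  by rewrite ffunE eqxx addr0.
by rewrite ffunE (negPf kl).
Qed.

Lemma in_add_id_factors W X : in_add W X -> id_factors W X.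
Proof.
move=> [n [Y [f [g fK gK]]]]; apply: id_factors_trans (id_factors_ffun W n) _.
apply: id_factors_trans (id_factors_fst X Y).
exact: (@id_factors_retract _ _ (linear_map (can_linear fK gK)) f).
Qed.

Definition ker_lift X Y Z (q : {linear X -> Y}) (h : {linear Z -> X})
    (hq : forall z, q (h z) = 0) (z : Z) : ker_mod q :=
  exist _ (h z) (introT eqP (hq z)).

Lemma ker_lift_linear X Y Z (q : {linear X -> Y}) (h : {linear Z -> X})
  (hq : forall z, q (h z) = 0) : linear (ker_lift hq).
Proof. by move=> a x y; apply: val_inj; rewrite /= linearP. Qed.

(** The complement of [X] in the power of [W] is the kernel of the
    retraction. *)
Lemma id_factors_in_add W X : id_factors W X -> in_add W X.
Proof.
move=> [I [i [r ir]]].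
pose s (x : X) : {ffun 'I_#|I| -> W} := [ffun k => i (enum_val k) x].
have s_lin : linear s by move=> a x y; apply/ffunP => k; rewrite !ffunE linearP.
pose q (f : {ffun 'I_#|I| -> W}) : X := \sum_k r (enum_val k) (f k).
have q_lin : linear q.
  move=> a f g; rewrite /q scaler_sumr -big_split; apply: eq_bigr => k _.
  by rewrite !ffunE linearP.
pose S := linear_map s_lin; pose Q := linear_map q_lin.
have SK x : Q (S x) = x.
  rewrite -[RHS]ir (reindex _ (onW_bij _ (@enum_val_bij I))).
  by apply: eq_bigr => k _; rewrite ffunE.
exists #|I|, (ker_mod Q).
pose E : {linear _ -> _} := idfun \- (S \o Q).
have QE f : Q (E f) = 0 by rewrite -[E f]/(f - S (Q f)) linearB SK subrr.
pose h f : X * ker_mod Q := (Q f, ker_lift QE f).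
have h_lin : linear h.
  move=> a f g; apply: injective_projections; first exact: linearP.
  exact: ker_lift_linear.
exists (linear_map h_lin), (fun u => S u.1 + val u.2) => [f|[x [f fQ]]].
  by rewrite /= addrC subrK.
have Qf : Q f = 0 by apply/eqP.
have QSf : Q (S x + f) = x by rewrite linearD SK Qf addr0.
apply: injective_projections; first exact: QSf.
by apply: val_inj; rewrite -[LHS]/(S x + f - S (Q (S x + f))) QSf addrC addKr.
Qed.

Lemma ker_modP X Y (q : {linear X -> Y}) (x : ker_mod q) : q (val x) = 0.
Proof. by apply/eqP; apply: (valP x). Qed.

(** Schanuel's lemma in disguise. Lift the maps [Z -> V -> Z] whose sum is the
    identity to maps [phi : F -> P] and [psi : P -> F]. They restrict to the
    kernels, and [1 - \sum psi phi] maps [F] into the kernel of [g]; so the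
    identity of that kernel is [\sum psi phi], factoring through the kernel of
    [p], plus a map factoring through [F]. *)
Lemma id_factors_ker P V F Z (p : {linear P -> V}) (g : {linear F -> Z}) :
    projective P -> projective F -> surjective p -> surjective g ->
  id_factors V Z -> id_factors (ker_mod p * F)%type (ker_mod g).
Proof.
move=> Pproj Fproj p_surj g_surj [I [i [r ir]]].
have [phi phiP] := choice (fun j => Fproj _ _ p (i j \o g) p_surj).
have [psi psiP] := choice (fun j => Pproj _ _ g (r j \o p) g_surj).
pose incl_g := val : {linear ker_mod g -> F}.
pose incl_p := val : {linear ker_mod p -> P}.
have phi0 j z : p ((phi j \o incl_g) z) = 0.
  by rewrite phiP /= ker_modP linear0.
have psi0 j z : g ((psi j \o incl_p) z) = 0.
  by rewrite psiP /= ker_modP linear0.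
pose err z := z - \sum_j psi j (phi j z).
have err_lin : linear err.
  move=> a x y; rewrite /err scalerBr addrACA -opprD; congr (_ - _).
  rewrite scaler_sumr -big_split; apply: eq_bigr => j _.
  by rewrite !linearP.
have err0 z : g (linear_map err_lin z) = 0.
  rewrite linearB linear_sum; apply/eqP; rewrite subr_eq0 -{1}(ir (g z)).
  by apply/eqP/eq_bigr => j _; rewrite psiP /= phiP.
pose to_p := linear_map (@fst_linear (ker_mod p) F).
pose of_p := linear_map (@inl_linear (ker_mod p) F).
pose to_F := linear_map (@snd_linear (ker_mod p) F).
pose of_F := linear_map (@inr_linear (ker_mod p) F).
exists (I + unit)%type,
  (fun o => match o with
            | inl j => of_p \o linear_map (ker_lift_linear (phi0 j))
            | inr _ => of_F \o incl_g end : {linear _ -> _}),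
  (fun o => match o with
            | inl j => linear_map (ker_lift_linear (psi0 j)) \o to_p
            | inr _ => linear_map (ker_lift_linear err0) \o to_F end
     : {linear _ -> _}).
move=> z; apply: val_inj.
rewrite (linear_sum incl_g) big_sumType.
rewrite -[LHS]/(\sum_j psi j (phi j (val z)) + \sum_(_ : unit) err (val z)).
by rewrite big_const card_unit /= addr0 addrC subrK.
Qed.

(** Adding a surjection [l] to the inclusion of the kernel of [pi] gives a
    surjection whose kernel consists of the pairs [(- l b, b)] with [l b] in
    the kernel of [pi]. *)
Lemma ker_comp_short_exact F X Z (l : {linear F -> X}) (pi : {linear X -> Z}) :
    surjective l ->
  exists (f : {linear ker_mod (pi \o l) -> (ker_mod pi * F)%type})
         (g : {linear (ker_mod pi * F)%type -> X}), short_exact f g.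
Proof.
move=> l_surj.
pose incl := val : {linear ker_mod (pi \o l) -> F}.
have l0 b : pi (((\- l) \o incl) b) = 0.
  rewrite -[((\- l) \o incl) b]/(- l (val b)) linearN.
  by rewrite -[pi _]/((pi \o l) (val b)) ker_modP oppr0.
pose f b : ker_mod pi * F := (ker_lift l0 b, incl b).
have f_lin : linear f.
  move=> a x y; apply: injective_projections; last exact: linearP.
  exact: ker_lift_linear.
pose g (u : ker_mod pi * F) := val u.1 + l u.2.
have g_lin : linear g.
  by move=> a u v; rewrite /g /= !linearP /= scalerDr addrACA.
exists (linear_map f_lin), (linear_map g_lin); split.
- by move=> b c [_ /val_inj].
- move=> [a b]; rewrite -[linear_map g_lin _]/(val a + l b).
  split=> [ab|[c fc]].
    have al : val a = - l b by apply/eqP; rewrite -addr_eq0 ab.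
    have bK : b \in ker_pred (pi \o l).
      by apply/eqP; rewrite /= -[l b]opprK -al linearN ker_modP oppr0.
    exists (exist _ b bK); apply: injective_projections => //.
    exact: val_inj.
  by have [<- <-] : f c = (a, b) := fc; apply: addNr.
- move=> x; have [b <-] := l_surj x; exists (0, b).
  by rewrite -[LHS]/(val (0 : ker_mod pi) + l b) linear0 add0r.
Qed.

End IdFactors.

(** Between modules killed by [I], the linear maps over [A] and over the
    quotient by [I] are the same, so a factorisation over the quotient is one
    over [A]. *)
Lemma id_factors_generator (A : pzRingType) (I : twoSidedIdeal A)
    (V : lmodType (ring_quot I)) (M : lmodType A) :
    additive_generator V -> fin_gen M ->
    (forall a (x : M), a \in I -> a *: x = 0) ->
  id_factors (restrict_scalars (ring_quot_proj I) V) M.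
Proof.
move=> [_ Vgen] Mfg IM.
have /in_add_id_factors[J [i [r ir]]] := Vgen _ (fin_gen_over_quot IM Mfg).
have i_lin j : linear (i j : M -> restrict_scalars (ring_quot_proj I) V).
  move=> a x y; rewrite -(over_quot_scale_proj IM); exact: (linearP (i j)).
have r_lin j : linear (r j : restrict_scalars (ring_quot_proj I) V -> M).
  move=> a x y; rewrite -(over_quot_scale_proj IM); exact: (linearP (r j)).
by exists J, (fun j => linear_map (i_lin j)), (fun j => linear_map (r_lin j)).
Qed.

(** * The resolution of a syzygy *)

Theorem proposition4p2 (R : comPzRingType) (A : algType R) (m : nat)
  (hA : artin_algebra A)
  (hm : (1 <= m)%N)
  (hJ : ideal_exp (jrad A) (2 * m + 1) =i pred1 0)
  (hC : finite_rep_type (ring_quot (ideal_exp (jrad A) m)))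
  (V : lmodType (ring_quot (ideal_exp (jrad A) m)))
  (hV : additive_generator V)
  (P : lmodType A)
  (p : {linear P ->
          restrict_scalars (ring_quot_proj (ideal_exp (jrad A) m)) V})
  (hp : projective_cover p) :
  one_Igusa_Todorov_witness
    (A^o * restrict_scalars (ring_quot_proj (ideal_exp (jrad A) m)) V
     * ker_mod p)%type.
Proof.
have Adcc := dcc_artin_algebra hA.
have VAfg := fin_gen_restrict (proj1 hV).
set J := jrad A; set VA := restrict_scalars _ V in p hp VAfg *.
set W := (A^o * VA * ker_mod p)%type.
have WA : id_factors W A^o.
  exact: id_factors_trans (id_factors_fst _ _) (id_factors_fst _ _).
have WV : id_factors W VA.
  exact: id_factors_trans (id_factors_fst _ _) (id_factors_snd _ _).
have WK : id_factors W (ker_mod p) by apply: id_factors_snd.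
have WF n : id_factors W {ffun 'I_n -> A^o}.
  exact: id_factors_trans WA (id_factors_ffun _ _).
split.
  apply: fin_gen_prod.
    by apply: fin_gen_prod VAfg; apply: fin_gen_regular.
  by apply: (fin_gen_ker Adcc hJ); apply: fin_gen_projective_cover hp _.
move=> Y Yfg Q q hq; set X := ker_mod q.
have Qfg := fin_gen_projective_cover hq Yfg.
have Xfg : fin_gen X := fin_gen_ker Adcc hJ q Qfg.
have XJ (x : X) : val x \in ideal_smul J Q.
  have [Qproj _ qsup] := hq.
  apply: (superfluous_sub_jrad Qproj Qfg (ker_pred_closed q) qsup).
  exact: (valP x).
(* [d * a] lies in [J ^ (2 m)] and [X] in [J Q]. *)
have JJX d a (x : X) : d \in ideal_exp J m -> a \in ideal_exp J m ->
    d *: (a *: x) = 0.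
  move=> dJ aJ; apply: val_inj; rewrite !linearZ linear0 /= scalerA.
  apply: (ideal_smul_annihilated (K := ideal_exp J (2 * m)) _ _ (XJ x)).
    move=> c b y cJ bJ; rewrite scalerA.
    have : c * b \in ideal_exp J (2 * m + 1) by rewrite ideal_expM ?ideal_exp1.
    by rewrite hJ => /eqP->; rewrite scale0r.
  by rewrite mul2n -addnn ideal_expM.
pose SC := ideal_smul_closed (ideal_exp J m) X.
pose Z := quot_mod SC; pose pi : {linear X -> Z} := quot_mod_proj SC.
have pi0 x : (pi x = 0) <-> (x \in ideal_smul (ideal_exp J m) X).
  rewrite -[x in X in _ <-> X]subr0; split.
    by rewrite -(linear0 pi) => /quot_mod_projP.
  by move/(quot_mod_projP SC); rewrite -[quot_mod_proj _ 0]/(pi 0) linear0.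
have [n [l l_surj]] := fin_gen_free_surj Xfg.
have pi_surj : surjective pi := @quot_mod_proj_surj _ _ _ SC.
have VKpi : id_factors VA (ker_mod pi).
  apply: id_factors_generator hV (fin_gen_ker Adcc hJ pi Xfg) _ => a x aJ.
  apply: val_inj; rewrite linearZ linear0.
  apply: (ideal_smul_annihilated JJX) => //; apply/pi0; exact: ker_modP.
have VZ : id_factors VA Z.
  apply: id_factors_generator hV (fin_gen_surj pi_surj Xfg) _ => a u aJ.
  have [x <-] := pi_surj u; rewrite -linearZ; apply/pi0; exact: ideal_smul_gen.
have [f [g fg]] := ker_comp_short_exact pi l_surj.
exists (ker_mod (pi \o l)), (ker_mod pi * {ffun 'I_n -> A^o})%type, f, g.
split=> //; apply: id_factors_in_add; last first.
  exact: id_factors_prod (id_factors_trans WV VKpi) (WF n).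
have [Pproj p_surj _] := hp.
apply: (id_factors_trans (id_factors_prod WK (WF n))).
apply: (id_factors_ker Pproj (@free_projective A n) p_surj _ VZ) => z.
have [x <-] := pi_surj z; have [c <-] := l_surj x; by exists c.
Qed.
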